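(* If $G$ is a connected graph, then $$W_{def}(G)\leq 1+def(G)+\max_{P\in \mathbf{P}}\sum_{v\in V(P)}\left(d_{G}(v)-1\right),$$ where $\mathbf{P}$ is the set of all shortest paths in $G$ (paths whose length equals the distance in $G$ between their endpoints) and $d_G(v)$ is the degree of $v$.
   Context: All graphs are finite, undirected, without loops or multiple edges. A proper $t$-edge-coloring of $G$ is a map $\alpha:E(G)\to\{1,\ldots,t\}$ such that all $t$ colors are used and adjacent edges receive different colors. The spectrum $S(v,\alpha)$ of a vertex $v$ is the set of colors on edges incident to $v$. For a finite set $A$ of integers, $def(A)=\max A-\min A-|A|+1$ ($def(\emptyset)=0$). Define $def(v,\alpha)=def(S(v,\alpha))$, $def(G,\alpha)=\sum_{v\in V(G)}def(v,\alpha)$, and $def(G)=\min_\alpha def(G,\alpha)$ over all proper edge-colorings $\alpha$ of $G$. $W_{def}(G)$ is the largest $t$ such that $G$ has a proper $t$-edge-coloring $\alpha$ with $def(G,\alpha)=def(G)$. *)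

(* Defs.v *)
From mathcomp Require Import all_boot all_order all_algebra finmap boolp.

Set Implicit Arguments.
Unset Strict Implicit.
Unset Printing Implicit Defensive.

Import Order.TTheory GRing.Theory Num.Theory.

Record sgraph := SGraph {
  vertex :> finType;
  adj : rel vertex;
  adj_sym : symmetric adj;
  adj_irr : irreflexive adj }.

(* The graph with no vertices is not considered connected. *)
Definition connected (G : sgraph) : Prop :=
  0 < #|G| /\ forall x y : G, connect (@adj G) x y.

Definition degree (G : sgraph) (v : G) : nat := #|[set u | adj v u]|.

Definition edges (G : sgraph) : {set {set G}} :=
  [set [set p.1; p.2] | p in [pred p : G * G | adj p.1 p.2]].

(* An edge coloring is a function on all sets of vertices; only its values on
   the edges matter. *)
Definition proper_edge_coloring (G : sgraph) (t : nat) (a : {set G} -> nat)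
    : Prop :=
  [/\ forall f, f \in edges G -> 1 <= a f <= t,
      forall c, 1 <= c <= t -> exists2 f, f \in edges G & a f = c
    & forall f g, f \in edges G -> g \in edges G -> f != g ->
        f :&: g != set0 -> a f <> a g].

Definition spectrum (G : sgraph) (a : {set G} -> nat) (v : G) : {fset nat} :=
  [fset a f | f in [set f in edges G | v \in f]]%fset.

Definition fset_max (A : {fset nat}) : nat := \max_(c <- A) c.

Definition fset_min (A : {fset nat}) : nat :=
  \big[Order.min/fset_max A]_(c <- A) c.

(* The truncated subtraction of #|` A| is exact: see [def_setE]. *)
Definition def_set (A : {fset nat}) : nat :=
  if A == fset0 then 0 else (fset_max A - fset_min A).+1 - #|` A|.

Definition def_vertex (G : sgraph) (a : {set G} -> nat) (v : G) : nat :=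
  def_set (spectrum a v).

Definition def_coloring (G : sgraph) (a : {set G} -> nat) : nat :=
  \sum_(v : G) def_vertex a v.

Section DefSetSpec.
Variable A : {fset nat}.

Lemma fset_max_ge c : c \in A -> c <= fset_max A.
Proof. by move=> cA; exact: leq_bigmax_seq. Qed.

Lemma fset_max_in : A != fset0 -> fset_max A \in A.
Proof.
move=> /fset0Pn [c0 c0A]; have := fset_max_ge c0A; rewrite /fset_max => le0.
have: (\max_(c <- A) c \in A) || (\max_(c <- A) c == 0).
  rewrite big_seq; elim/big_ind: _ => [|x y Hx Hy|c ->]; rewrite ?eqxx ?orbT //.
  by case/orP: (leq_total x y) => [/maxn_idPr|/maxn_idPl] ->.
case/orP=> // /eqP e0; rewrite e0 in le0 *.
by move: le0 c0A; rewrite leqn0 => /eqP ->.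
Qed.

Lemma fset_min_le c : c \in A -> fset_min A <= c.
Proof. by move=> cA; rewrite -leEnat; exact: ge_bigmin_seq. Qed.

Lemma fset_min_in : A != fset0 -> fset_min A \in A.
Proof.
move=> A0; rewrite /fset_min big_seq.
elim/big_ind: _ => [|x y Hx Hy|c ->] //; first exact: fset_max_in.
by rewrite minElt; case: ifP.
Qed.

Lemma def_setE : A != fset0 ->
  ((def_set A)%:Z =
    (fset_max A)%:Z - (fset_min A)%:Z - (#|` A|)%:Z + 1)%R.
Proof.
move=> A0; rewrite /def_set (negbTE A0).
have le_mM : fset_min A <= fset_max A by exact/fset_min_le/fset_max_in.
have leA : #|` A| <= (fset_max A - fset_min A).+1.
  rewrite -(size_iota (fset_min A) (fset_max A - fset_min A).+1).
  apply: uniq_leq_size => // c cA.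
  rewrite mem_iota fset_min_le //= addnS ltnS subnKC //.
  exact: fset_max_ge.
by rewrite -subzn // -addn1 PoszD -subzn // addrAC.
Qed.

End DefSetSpec.

Lemma proper_edge_coloring_le (G : sgraph) t (a : {set G} -> nat) :
  proper_edge_coloring t a -> t <= #|edges G|.
Proof.
case=> _ surj _.
rewrite -(size_iota 1 t) cardE -(size_map a).
apply: uniq_leq_size (iota_uniq _ _) _ => c; rewrite mem_iota add1n ltnS => ct.
by have [f fE <-] := surj c ct; apply: map_f; rewrite mem_enum.
Qed.

Lemma exists_proper_edge_coloring (G : sgraph) :
  exists t (a : {set G} -> nat), proper_edge_coloring t a.
Proof.
exists #|edges G|, (fun f => (index f (enum (edges G))).+1); split.
- by move=> f fE; rewrite /= cardE index_mem mem_enum.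
- case=> //= c; rewrite cardE => cE; exists (nth set0 (enum (edges G)) c).
    by rewrite -mem_enum mem_nth.
  by rewrite index_uniq ?enum_uniq.
- move=> f g fE gE /eqP fg _ [] eq_i; apply: fg.
  by rewrite -(nth_index set0 (_ : f \in enum (edges G))) ?mem_enum // eq_i
    nth_index ?mem_enum.
Qed.

Lemma exists_def_coloring (G : sgraph) :
  exists d, `[< exists t (a : {set G} -> nat),
    proper_edge_coloring t a /\ def_coloring a = d >].
Proof.
have [t [a ta]] := exists_proper_edge_coloring G.
by exists (def_coloring a); apply/asboolP; exists t, a.
Qed.

Definition def_graph (G : sgraph) : nat := ex_minn (exists_def_coloring G).

Lemma exists_W_def (G : sgraph) :
  exists t, `[< exists a : {set G} -> nat,
    proper_edge_coloring t a /\ def_coloring a = def_graph G >].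
Proof.
rewrite /def_graph; case: ex_minnP => d /asboolP [t [a ta]] _.
by exists t; apply/asboolP; exists a.
Qed.

Lemma W_def_bound (G : sgraph) t :
  `[< exists a : {set G} -> nat,
    proper_edge_coloring t a /\ def_coloring a = def_graph G >] ->
  t <= #|edges G|.
Proof. by case/asboolP=> a [/proper_edge_coloring_le]. Qed.

Definition W_def (G : sgraph) : nat :=
  ex_maxn (exists_W_def G) (@W_def_bound G).

(* A path is the nonempty sequence of its vertices; a path with a single
   vertex has length 0. *)
Definition is_path (G : sgraph) (s : seq G) : bool :=
  if s is x :: p then path (@adj G) x p && uniq s else false.

Definition path_length (G : sgraph) (s : seq G) : nat := (size s).-1.

Definition joins (G : sgraph) (x y : G) (s : seq G) : bool :=
  if s is z :: p then (z == x) && (last z p == y) else false.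

(* A path has at most #|G| vertices, so that ranging over the finite type
   #|G|.-bseq G loses no path; the default #|G| is reached only when no path
   joins x and y. *)
Definition dist (G : sgraph) (x y : G) : nat :=
  \big[Order.min/#|G|]_(s : #|G|.-bseq G | is_path s && joins x y s) path_length s.

Definition shortest_path (G : sgraph) (s : seq G) : bool :=
  if s is x :: p then is_path s && (path_length s == dist x (last x p))
  else false.

Local Open Scope ring_scope.

Definition path_weight (G : sgraph) (s : seq G) : int :=
  \sum_(v <- s) ((degree v)%:Z - 1).

(* Integer-valued: on the one-vertex graph the maximum is -1. As every
   shortest path has weight at least -1, the default -1 does not affect the
   maximum: see [max_path_weight_ge] and [max_path_weight_attained]. *)
Definition max_path_weight (G : sgraph) : int :=
  \big[Order.max/-1]_(s : #|G|.-bseq G | shortest_path s) path_weight s.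

Lemma is_path_size (G : sgraph) (s : seq G) : is_path s -> (size s <= #|G|)%N.
Proof.
by case: s => // x p /andP [_ us]; rewrite -(card_uniqP us) max_card.
Qed.

Lemma dist_le (G : sgraph) (x : G) (p : seq G) :
  is_path (x :: p) -> (dist x (last x p) <= size p)%N.
Proof.
move=> xp; have sz := is_path_size xp.
rewrite /dist (bigminD1 (Bseq sz)) /=; first by rewrite -leEnat ge_min lexx.
by move: xp; rewrite /= !eqxx !andbT.
Qed.

Lemma dist_attained (G : sgraph) (x y : G) : connect (@adj G) x y ->
  exists2 p, is_path (x :: p) & last x p = y /\ size p = dist x y.
Proof.
case/connectP=> q0 q0P y_last; case/shortenP: q0P y_last => q qP qU _ y_last.
have xq : is_path (x :: q) by rewrite /= qP.
have: (dist x y = #|G|) \/ exists2 s : seq G, is_path s && joins x y s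
    & path_length s = dist x y.
  rewrite /dist; elim/big_ind: _ => [|m n Hm Hn|s Hs]; first by left.
    by rewrite minElt; case: ifP.
  by right; exists (s : seq G).
case=> [dG|[[//|z p] /andP [zp /andP [/eqP zx /eqP lz]] sp]].
  by have := dist_le xq; have := is_path_size xq; rewrite -y_last dG /= => /leq_trans h /h; rewrite ltnn.
by subst z; exists p.
Qed.

Lemma path_weight_ge (G : sgraph) (s : seq G) :
  is_path s -> -1 <= path_weight s.
Proof.
case: s => [//|x [|y p]]; rewrite /path_weight.
  by move=> _; rewrite big_seq1 lerBrDr.
move=> /andP [xyp _]; apply: le_trans (_ : 0 <= _) => //.
rewrite big_seq sumr_ge0 // => v vs.
suff: exists u, adj v u.
  move=> [u vu]; rewrite subr_ge0 lez_nat card_gt0; apply/set0Pn.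
  by exists u; rewrite inE.
move: vs; rewrite in_cons => /predU1P [->|vs].
  by exists y; case/andP: xyp.
move: xyp; case/splitPr: vs => s1 s2; rewrite cat_path /= => /and3P [_ adj_v _].
by exists (last x s1); rewrite adj_sym.
Qed.

Lemma max_path_weight_ge (G : sgraph) (s : seq G) :
  shortest_path s -> path_weight s <= max_path_weight G.
Proof.
move=> ss; have sz : (size s <= #|G|)%N.
  by apply: is_path_size; case: s ss => // x p /andP [].
exact: (@le_bigmax_cond _ _ _ _ (Bseq sz)).
Qed.

Lemma max_path_weight_attained (G : sgraph) : connected G ->
  exists2 s : seq G, shortest_path s & path_weight s = max_path_weight G.
Proof.
case=> /card_gt0P [v _] _.
have sv : shortest_path [:: v].
  by rewrite /= /path_length /= eq_sym -leqn0 (@dist_le G v [::]).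
have := max_path_weight_ge sv; have := @path_weight_ge G [:: v] isT.
have : max_path_weight G = -1 \/
    exists2 s : seq G, shortest_path s & path_weight s = max_path_weight G.
  rewrite /max_path_weight; elim/big_ind: _ => [|x y Hx Hy|s Hs].
  - by left.
  - by rewrite maxElt; case: ifP.
  - by right; exists (s : seq G).
case=> // -> w_ge w_le; exists [:: v] => //.
by apply/eqP; rewrite eq_le w_le w_ge.
Qed.

(* Main.v *)
Require Import Defs.
From mathcomp Require Import all_boot all_order all_algebra.
From mathcomp Require Import finmap boolp zify.

(** Two colors seen at a vertex [v] differ by at most
    [max - min = d(v) - 1 + def(v)]. Take an edge of color 1, an edge of color
    [t], and a shortest path from an endpoint of the first to an endpoint of
    the second: the colors of consecutive edges along the way are seen at a
    common vertex of the path, so [t - 1] is at most the sum of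
    [d(v) - 1 + def(v)] over the path, and the deficiencies on the path sum to
    at most the deficiency of the coloring. *)

Set Implicit Arguments.
Unset Strict Implicit.
Unset Printing Implicit Defensive.

Import Order.TTheory GRing.Theory Num.Theory.

Section Coloring.
Variables (G : sgraph) (a : {set G} -> nat).

Lemma edgesP (f : {set G}) :
  reflect (exists x y, adj x y /\ f = [set x; y]) (f \in edges G).
Proof.
apply: (iffP imsetP) => [[[x y] /= xy ->]|[x [y [xy ->]]]].
  by exists x, y.
by exists (x, y).
Qed.

Lemma mem_spectrum (f : {set G}) (v : G) :
  f \in edges G -> v \in f -> a f \in spectrum a v.
Proof. by move=> fE vf; apply: in_imfset; rewrite /= inE fE vf. Qed.

Lemma mem_spectrum_adj (x y : G) : adj x y ->
  a [set x; y] \in spectrum a x /\ a [set x; y] \in spectrum a y.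
Proof.
move=> xy; have xyE : [set x; y] \in edges G by apply/edgesP; exists x, y.
by split; apply: mem_spectrum; rewrite // !inE eqxx ?orbT.
Qed.

(** Every edge at [v] is the image of a neighbor [u] under [u |-> [set v; u]]. *)
Lemma card_incident_le_degree (v : G) :
  #|[set f in edges G | v \in f]| <= degree v.
Proof.
apply: leq_trans (leq_imset_card (fun u => [set v; u]) [set u | adj v u]).
apply: subset_leq_card; apply/subsetP => f; rewrite inE => /andP [/edgesP].
case=> x [y [xy ->]]; rewrite !inE => /orP [] /eqP ->.
  by apply: imset_f; rewrite inE.
by rewrite setUC; apply: imset_f; rewrite inE adj_sym.
Qed.

Lemma card_spectrum_le_degree (v : G) : #|` spectrum a v|%fset <= degree v.
Proof.
apply: leq_trans (card_incident_le_degree v).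
by rewrite [leqRHS]cardE; exact: leq_imfset_card.
Qed.

Local Open Scope ring_scope.

Lemma spectrum_diff_le (v : G) (c d : nat) :
  c \in spectrum a v -> d \in spectrum a v ->
  d%:Z - c%:Z <= (degree v)%:Z - 1 + (def_vertex a v)%:Z.
Proof.
move=> cS dS; have S0 : spectrum a v != fset0 by apply/fset0Pn; exists c.
rewrite /def_vertex def_setE //.
have := fset_max_ge dS; have := fset_min_le cS; have := card_spectrum_le_degree v.
lia.
Qed.

Lemma path_color_diff_le (x : G) (p : seq G) (c d : nat) :
  path (@adj G) x p -> c \in spectrum a x -> d \in spectrum a (last x p) ->
  d%:Z - c%:Z <= \sum_(v <- x :: p) ((degree v)%:Z - 1 + (def_vertex a v)%:Z).
Proof.
elim: p x c => [|y p IHp] x c /=; first by rewrite big_seq1 => _; apply: spectrum_diff_le.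
case/andP=> /mem_spectrum_adj [xyx xyy] yp cx dp; rewrite big_cons.
(* The color of the first edge lies in the spectra of both [x] and [y]: it ends the step at [x] and
   replaces [c] in the induction from [y]. *)
rewrite -(subrKA (a [set x; y])%:Z) addrC.
exact: lerD (spectrum_diff_le cx xyx) (IHp _ _ yp xyy dp).
Qed.

(** Without repetitions, the left side is a partial sum of the nonnegative terms of
    [def_coloring a]. *)
Lemma sum_def_vertex_le (s : seq G) : uniq s ->
  \sum_(v <- s) (def_vertex a v)%:Z <= (def_coloring a)%:Z.
Proof.
move=> s_uniq; rewrite -(big_morph Posz PoszD (erefl _)) lez_nat.
rewrite big_uniq // /def_coloring [leqRHS](bigID (mem s)) /=.
exact: leq_addr.
Qed.

Lemma proper_edge_coloring_le_weight (t : nat) :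
  connected G -> proper_edge_coloring t a ->
  t%:Z <= 1 + (def_coloring a)%:Z + max_path_weight G.
Proof.
(* For [t = 0] no edge has color 1; the bound holds because path weights are at least -1. *)
move=> hG [_ surj _]; case: t surj => [_|t surj].
  have [s s_short <-] := max_path_weight_attained hG.
  have : -1 <= path_weight s.
    by apply: path_weight_ge; case: s s_short => // x p /andP [].
  lia.
have [//|e /edgesP [x [x' [xx' ->]]] a1] := surj 1.
have [|f /edgesP [y [y' [yy' ->]]] at1] := surj t.+1; first by rewrite /= leqnn.
(* Any choice of endpoints works; if [x = y], then [p] is empty. *)
have [p xp [lp sp]] := dist_attained (hG.2 x y).
have xp_short : shortest_path (x :: p).
  by rewrite /shortest_path xp /path_length /= lp sp eqxx.
have [xpath xuniq] := andP xp.
have [+ _] := mem_spectrum_adj xx'; rewrite a1 => x1.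
have [+ _] := mem_spectrum_adj yy'; rewrite at1 -lp => yt.
have := path_color_diff_le xpath x1 yt; rewrite big_split /= lerBlDr => t_le.
rewrite -addrA addrC (le_trans t_le) // lerD2r addrC.
exact: lerD (sum_def_vertex_le xuniq) (max_path_weight_ge xp_short).
Qed.

End Coloring.

Theorem theorem2p2 (G : sgraph) (hG : connected G) :
  ((W_def G)%:Z <= 1 + (def_graph G)%:Z + max_path_weight G)%R.
Proof.
(* The maximum [W_def G] is attained by a coloring of deficiency [def_graph G]. *)
rewrite /W_def; case: ex_maxnP => t /asboolP [a [ta <-]] _.
exact: proper_edge_coloring_le_weight.
Qed.
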